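(* Let $\Lambda$ be a set of standard formulas of $\mathcal{L}_{\mathtt{CL}}$ closed under standard substitution. If $\mathcal{A}$ is an $\mathtt{inq}\Lambda$-algebra and $\mathcal{A}\nvDash^c\phi$, then there is a finite $\mathtt{inq}\Lambda$-algebra $\mathcal{B}$ such that $\mathcal{B}\nvDash^c\phi$.
   Context: Formulas of $\mathcal{L}_{\mathtt{CL}}$ are generated from a countable set $\mathtt{At}$ of variables by $\bot,\land,\lor,\to$; a formula is standard if it contains no $\lor$; a standard substitution replaces atoms by standard formulas. A Brouwerian semilattice is $(B,\land,\to,0)$ with $(B,\land)$ a meet-semilattice with least element $0$ and $a\land b\le c\iff a\le b\to c$. An inquisitive algebra is a first-order structure $\mathcal{A}=(A,A_c,\land,\lor,\to,0)$ with a unary predicate $A_c\subseteq A$ (the core) such that, with $\langle A_c\rangle$ the closure of $A_c$ under $\land,\lor,\to,0$, $(\langle A_c\rangle,\lor,\land,\to,0)$ is a Heyting algebra; $(A_c,\land,\to,0)$ is a Brouwerian semilattice; and $a\to(x\lor y)=(a\to x)\lor(a\to y)$ for all $a\in A_c$, $x,y\in\langle A_c\rangle$. $1:=0\to0$. A core valuation is $\mu:\mathtt{At}\to A_c$, extended homomorphically to formulas; $\mathcal{A}\vDash^c\phi$ means $\phi$ evaluates to $1$ under every core valuation. An $\mathtt{inq}\Lambda$-algebra is an inquisitive algebra with $\mathcal{A}\vDash^c\psi$ for all $\psi\in\Lambda$. *)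

(* Defs.v *)
From mathcomp Require Import all_boot.
From mathcomp Require Import all_classical.

Set Implicit Arguments.
Unset Strict Implicit.
Unset Printing Implicit Defensive.

Local Open Scope classical_set_scope.

Inductive formula (At : countType) : Type :=
| Var of At
| Bot
| And of formula At & formula At
| Or of formula At & formula At
| Imp of formula At & formula At.

Arguments Bot {At}.

Fixpoint standard (At : countType) (phi : formula At) : bool :=
  match phi with
  | Var _ | Bot => true
  | And phi1 phi2 | Imp phi1 phi2 => standard phi1 && standard phi2
  | Or _ _ => false
  end.

Fixpoint subst (At : countType) (sigma : At -> formula At) (phi : formula At) :
    formula At :=
  match phi with
  | Var p => sigma p
  | Bot => Bot
  | And phi1 phi2 => And (subst sigma phi1) (subst sigma phi2)
  | Or phi1 phi2 => Or (subst sigma phi1) (subst sigma phi2)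
  | Imp phi1 phi2 => Imp (subst sigma phi1) (subst sigma phi2)
  end.

Definition standard_subst_closed (At : countType) (L : set (formula At)) :=
  forall sigma : At -> formula At, (forall p, standard (sigma p)) ->
  forall psi, L psi -> L (subst sigma psi).

(* The predicates below say that a subset S of T, with the restrictions of    *)
(* operations defined on all of T, is an algebra of the given kind; nothing   *)
(* is required of the operations outside S. The order is x <= y iff           *)
(* meet x y = x.                                                              *)

Record semilattice_on (T : Type) (S : set T) (op : T -> T -> T) : Prop := {
  op_closed : forall x y, S x -> S y -> S (op x y);
  op_comm : forall x y, S x -> S y -> op x y = op y x;
  op_assoc : forall x y z, S x -> S y -> S z -> op x (op y z) = op (op x y) z;
  op_idem : forall x, S x -> op x x = x
}.

Record brouwerian_semilattice_on (T : Type) (S : set T)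
    (meet imp : T -> T -> T) (bot : T) : Prop := {
  brouwerian_meet : semilattice_on S meet;
  imp_closed : forall x y, S x -> S y -> S (imp x y);
  bot_closed : S bot;
  bot_least : forall x, S x -> meet bot x = bot;
  imp_residual : forall x y z, S x -> S y -> S z ->
    (meet (meet x y) z = meet x y <-> meet x (imp y z) = x)
}.

Record lattice_on (T : Type) (S : set T) (meet join : T -> T -> T) : Prop := {
  lattice_meet : semilattice_on S meet;
  lattice_join : semilattice_on S join;
  meet_absorb : forall x y, S x -> S y -> meet x (join x y) = x;
  join_absorb : forall x y, S x -> S y -> join x (meet x y) = x
}.

Record heyting_on (T : Type) (S : set T)
    (join meet imp : T -> T -> T) (bot : T) : Prop := {
  heyting_lattice : lattice_on S meet join;
  heyting_brouwerian : brouwerian_semilattice_on S meet imp bot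
}.

Record inq_struct : Type := InqStruct {
  carrier :> Type;
  core : set carrier;
  imeet : carrier -> carrier -> carrier;
  ijoin : carrier -> carrier -> carrier;
  iimp : carrier -> carrier -> carrier;
  ibot : carrier
}.

Arguments core : clear implicits.
Arguments ibot : clear implicits.

Inductive core_closure (A : inq_struct) : set A :=
| closure_core x : core A x -> core_closure x
| closure_bot : core_closure (ibot A)
| closure_meet x y :
    core_closure x -> core_closure y -> core_closure (imeet x y)
| closure_join x y :
    core_closure x -> core_closure y -> core_closure (ijoin x y)
| closure_imp x y :
    core_closure x -> core_closure y -> core_closure (iimp x y).

Record inq_algebra (A : inq_struct) : Prop := {
  inq_heyting :
    heyting_on (@core_closure A) (@ijoin A) (@imeet A) (@iimp A) (ibot A);
  inq_brouwerian :
    brouwerian_semilattice_on (core A) (@imeet A) (@iimp A) (ibot A);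
  inq_split : forall a x y : A, core A a -> core_closure x -> core_closure y ->
    iimp a (ijoin x y) = ijoin (iimp a x) (iimp a y)
}.

Definition itop (A : inq_struct) : A := iimp (ibot A) (ibot A).

Fixpoint eval (At : countType) (A : inq_struct) (mu : At -> A)
    (phi : formula At) : A :=
  match phi with
  | Var p => mu p
  | Bot => ibot A
  | And phi1 phi2 => imeet (eval mu phi1) (eval mu phi2)
  | Or phi1 phi2 => ijoin (eval mu phi1) (eval mu phi2)
  | Imp phi1 phi2 => iimp (eval mu phi1) (eval mu phi2)
  end.

Definition core_valid (At : countType) (A : inq_struct) (phi : formula At) :=
  forall mu : At -> A, (forall p, core A (mu p)) -> eval mu phi = itop A.

Definition inq_L_algebra (At : countType) (L : set (formula At))
    (A : inq_struct) : Prop :=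
  inq_algebra A /\ forall psi, L psi -> core_valid A psi.

(* Main.v *)
(** Let mu be a core valuation refuting phi. The implicative subsemilattice H
    of the core generated by 0 and the values mu p, for the atoms p of phi, is
    finite by Diego's theorem. Since a -> (x \/ y) = (a -> x) \/ (a -> y) for a
    in H, the finite joins of elements of H form a finite subalgebra; with core
    H it is the required countermodel, Lambda being inherited from A.

    Diego's theorem is proved by induction on the number of generators. Two
    elements t, s with t not below s are separated by a filter M containing t
    and maximal among those missing s. In the quotient by M the class of s is
    the unique coatom, which can only be the class of a generator x. Below this
    coatom x acts as 1, so every element is congruent modulo M to x or to one
    of the finitely many elements generated without x. Hence finitely many
    tables determine all such M, and finitely many M determine the elements. *)

Require Import Defs.
From mathcomp Require Import all_boot finmap.
From mathcomp Require Import all_classical.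

Set Implicit Arguments.
Unset Strict Implicit.
Unset Printing Implicit Defensive.

Local Open Scope classical_set_scope.

(** * Finiteness of powersets and transfer along injections *)

Lemma finite_powerset (T : Type) (A : set T) :
  finite_set A -> finite_set [set X | X `<=` A].
Proof.
elim/Pchoice: T => T in A *; move=> Afin.
apply: (@sub_finite_set _ _
  ((fun Z : {fset T} => [set` Z]) @` [set` fpowerset (fset_set A)])).
  move=> X /= XA; have Xfin := sub_finite_set XA Afin.
  exists (fset_set X); last by rewrite fset_setK.
  rewrite /= fpowersetE; apply/fsubsetP => x.
  by rewrite !in_fset_set // !inE => /XA.
exact/finite_image/finite_fset.
Qed.

Lemma finite_set_injective_on (T U : Type) (A : set T) (B : set U) (f : T -> U) :
  (forall x, A x -> B (f x)) ->
  (forall x y, A x -> A y -> f x = f y -> x = y) ->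
  finite_set B -> finite_set A.
Proof.
move=> fAB finj Bfin.
have finjA : {in A &, injective f} by move=> x y; rewrite !inE; exact: finj.
have <- := eq_finite_set (inj_card_eq finjA).
by apply: sub_finite_set Bfin => _ [x Ax <-]; exact: fAB.
Qed.

(** * Implicative semilattices and the forcing reading of their order *)

Record implicative_semilattice (T : Type) (meet imp : T -> T -> T) (top : T) :
    Prop := {
  ismeetC : forall x y, meet x y = meet y x;
  ismeetA : forall x y z, meet x (meet y z) = meet (meet x y) z;
  ismeetxx : forall x, meet x x = x;
  ismeetx1 : forall x, meet x top = x;
  isresidual : forall x y z,
    meet (meet x y) z = meet x y <-> meet x (imp y z) = x
}.

Section ImplicativeSemilattice.
Variables (T : Type) (meet imp : T -> T -> T) (top : T).
Hypothesis TP : implicative_semilattice meet imp top.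

Local Notation "x <=' y" := (meet x y = x) (at level 70).
Local Notation "x ==>' y" := (imp x y) (at level 55, right associativity).
Local Notation "x /\' y" := (meet x y) (at level 50, left associativity).

Inductive generated (G : set T) : set T :=
| generated_gen x : G x -> generated G x
| generated_top : generated G top
| generated_meet x y :
    generated G x -> generated G y -> generated G (x /\' y)
| generated_imp x y :
    generated G x -> generated G y -> generated G (x ==>' y).

Lemma generated_subset (G G' : set T) :
  G `<=` G' -> generated G `<=` generated G'.
Proof.
move=> GG' t; elim=> [x /GG'||x y _ gx _|x y _ gx _].
- exact: generated_gen.
- exact: generated_top.
- exact: generated_meet.
- exact: generated_imp.
Qed.

Lemma is_refl x : x <=' x. Proof. exact: ismeetxx TP x. Qed.

Lemma is_trans y x z : x <=' y -> y <=' z -> x <=' z.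
Proof. by move=> xy yz; rewrite -xy -(ismeetA TP) yz. Qed.

Lemma is_anti x y : x <=' y -> y <=' x -> x = y.
Proof. by move=> xy yx; rewrite -xy (ismeetC TP). Qed.

(* Together with the next lemma, this lets "w <= x" be read as "w forces x" in
   a Kripke model, so that identities become first-order tautologies. *)
Lemma forces_meet w x y : w <=' x /\' y <-> w <=' x /\ w <=' y.
Proof.
split=> [wxy|[wx wy]]; last by rewrite (ismeetA TP) wx.
split; apply: is_trans wxy _; last by rewrite -(ismeetA TP) (ismeetxx TP).
by rewrite (ismeetC TP) (ismeetA TP) (ismeetxx TP).
Qed.

Lemma forces_imp w x y :
  w <=' x ==>' y <-> forall v, v <=' w -> v <=' x -> v <=' y.
Proof.
split=> [/(isresidual TP) wxy v vw vx|wxy].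
  by apply: is_trans wxy; apply/forces_meet.
by apply/(isresidual TP)/wxy; have /forces_meet[] := is_refl (w /\' x).
Qed.

Lemma forces_top w : w <=' top. Proof. exact: ismeetx1 TP w. Qed.

Lemma forces_le x y : (forall w, w <=' x -> w <=' y) -> x <=' y.
Proof. by apply; exact: is_refl. Qed.

Lemma forces_eq x y : (forall w, w <=' x <-> w <=' y) -> x = y.
Proof. by move=> xy; apply: is_anti; apply: forces_le => w /xy. Qed.

Lemma imp_top x y : x ==>' y = top <-> x <=' y.
Proof.
split=> [xy|xy].
  have /forces_imp : top <=' x ==>' y by rewrite xy; exact: is_refl.
  by apply; [exact: forces_top|exact: is_refl].
apply: is_anti; first exact: forces_top.
by apply/forces_imp => v _ /is_trans; apply.
Qed.

(** * Filters, their quotients and separation by maximal filters *)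

Record is_filter (M : set T) : Prop := {
  filter_top : M top;
  filter_mp : forall x y, M (x ==>' y) -> M x -> M y
}.

Section Filter.
Variables (M : set T) (MF : is_filter M).

(** The order of the quotient by [M], kept as a preorder on [T]; [feq] below is the corresponding
    congruence. *)
Definition fle x y := M (x ==>' y).

Lemma filter_le x y : x <=' y -> M x -> M y.
Proof.
by move/imp_top => xy Mx; apply: (filter_mp MF) Mx; rewrite xy; case: MF.
Qed.

Lemma filter_meet x y : M x -> M y -> M (x /\' y).
Proof.
move=> Mx My; apply: (filter_mp MF) My; apply: filter_le Mx.
apply/forces_imp => v vx vy; exact/forces_meet.
Qed.

Lemma fle_le x y : x <=' y -> fle x y.
Proof. by rewrite /fle => /imp_top->; case: MF. Qed.

Lemma fle_refl x : fle x x. Proof. exact/fle_le/is_refl. Qed.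

Lemma fle_trans y x z : fle x y -> fle y z -> fle x z.
Proof.
move=> xy yz; apply: filter_le (filter_meet xy yz); apply: forces_le => w.
move=> /forces_meet[/forces_imp wxy /forces_imp wyz].
by apply/forces_imp => v vw vx; apply: wyz => //; exact: wxy.
Qed.

Lemma fle_top x : fle x top. Proof. exact/fle_le/forces_top. Qed.

Lemma filter_fle x : M x <-> fle top x.
Proof.
split=> [|Mx]; last by apply: (filter_mp MF) Mx _; case: MF.
by apply: filter_le; apply/forces_imp => v vx _.
Qed.

Lemma fle_meet w x y : fle w (x /\' y) <-> fle w x /\ fle w y.
Proof.
split=> [wxy|[wx wy]].
  by split; apply: fle_trans wxy _; apply/fle_le/forces_le => v /forces_meet[].
apply: filter_le (filter_meet wx wy); apply: forces_le => v.
move=> /forces_meet[/forces_imp vx /forces_imp vy]; apply/forces_imp => u uv uw.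
by apply/forces_meet; split; [exact: vx|exact: vy].
Qed.

Lemma fle_imp w x y :
  fle w (x ==>' y) <-> forall v, fle v w -> fle v x -> fle v y.
Proof.
split=> [wxy v vw vx|wxy].
  have /filter_le : (w ==>' x ==>' y) /\' (v ==>' w) /\' (v ==>' x)
                      <=' (v ==>' y).
    apply: forces_le => u /forces_meet[/forces_meet[/forces_imp a]].
    move=> /forces_imp b /forces_imp c; apply/forces_imp => t tu tv.
    have /forces_imp := a t tu (b t tu tv).
    by apply; [exact: is_refl|exact: c].
  by apply; apply: filter_meet => //; apply: filter_meet.
have [wxyw wxyx] : fle (w /\' x) w /\ fle (w /\' x) x.
  by apply/fle_meet; exact: fle_refl.
apply: filter_le (wxy _ wxyw wxyx); apply/forces_imp => v + vw.
move=> /forces_imp h; apply/forces_imp => u uv ux; apply: h => //.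
by apply/forces_meet; split=> //; exact: is_trans vw.
Qed.

Lemma fle_meetl x y : fle (x /\' y) x.
Proof. by have [] := (fle_meet (x /\' y) x y).1 (fle_refl _). Qed.

Lemma fle_meetr x y : fle (x /\' y) y.
Proof. by have [] := (fle_meet (x /\' y) x y).1 (fle_refl _). Qed.

Definition feq x y := fle x y /\ fle y x.

Lemma feq_refl x : feq x x. Proof. by split; exact: fle_refl. Qed.

Lemma feq_sym x y : feq x y -> feq y x. Proof. by case. Qed.

Lemma feq_trans y x z : feq x y -> feq y z -> feq x z.
Proof. by move=> [? ?] [? ?]; split; exact: (@fle_trans y). Qed.

Lemma feq_meet x y x' y' : feq x x' -> feq y y' -> feq (x /\' y) (x' /\' y').
Proof.
have H a b a' b' : fle a a' -> fle b b' -> fle (a /\' b) (a' /\' b').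
  move=> aa bb; apply/fle_meet; split; [apply: fle_trans aa|apply: fle_trans bb].
    exact: fle_meetl.
  exact: fle_meetr.
by move=> [? ?] [? ?]; split; apply: H.
Qed.

Lemma feq_imp x y x' y' : feq x x' -> feq y y' -> feq (x ==>' y) (x' ==>' y').
Proof.
have H a b a' b' : fle a' a -> fle b b' -> fle (a ==>' b) (a' ==>' b').
  move=> aa bb; apply/fle_imp => v /fle_imp vab va'; apply: fle_trans bb.
  by apply: vab; [exact: fle_refl|exact: fle_trans aa].
by move=> [? ?] [? ?]; split; apply: H.
Qed.

Lemma feq_filter x y : feq x y -> M x -> M y.
Proof. by move=> [xy _]; exact: (filter_mp MF) xy. Qed.

Lemma feq_bimp x y : feq x y <-> M ((x ==>' y) /\' (y ==>' x)).
Proof.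
split=> [[]|]; first exact: filter_meet.
by move=> h; split; apply: filter_le h; apply: forces_le => v /forces_meet[].
Qed.

End Filter.

(** Zorn's lemma gives a filter maximal among those containing [t] and missing [s]; the last clause
    is what maximality yields. *)
Lemma maximal_filter t s : ~ t <=' s ->
  exists M, [/\ is_filter M, M t, ~ M s & forall u, M u \/ M (u ==>' s)].
Proof.
move=> nts.
pose P (X : set T) := (X = set0 \/ is_filter X /\ X t) /\ ~ X s.
have chainP (F : set (set T)) : F `<=` P -> total_on F subset ->
    P (\bigcup_(X in F) X).
  move=> FP Ftot; split; last by move=> [X /FP[]].
  have [[X [FX Xn0]]|allF0] := pselect (exists X, F X /\ X <> set0).
    right; have [[//|[XF Xt]] _] := FP _ FX.
    split; last by exists X.
    split=> [|x y [X1 FX1 X1xy] [X2 FX2 X2x]]; first by exists X; case: XF.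
    have [Y [FY Yxy Yx]] : exists Y, [/\ F Y, Y (x ==>' y) & Y x].
      by have [X12|X21] := Ftot _ _ FX1 FX2;
        [exists X2|exists X1]; split=> //; [exact: X12|exact: X21].
    have [[Y0|[YF _]] _] := FP _ FY; first by rewrite Y0 in Yx.
    by exists Y => //; exact: (filter_mp YF) Yxy Yx.
  left; apply/seteqP; split=> // x [X FX Xx]; apply: allF0; exists X.
  by split=> // X0; rewrite X0 in Xx.
have [M [[[M0|[MF Mt]] nMs] Mmax]] := Zorn_bigcup chainP.
  exfalso; apply: (Mmax [set y | t <=' y]).
    split=> [|/(_ t (is_refl t))]; first by rewrite M0.
    by rewrite M0.
  split=> //; right; split; last exact: is_refl.
  split=> [|x y /= /forces_imp txy tx]; first exact: forces_top.
  by apply: txy => //; exact: is_refl.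
exists M; split=> // u; apply/or_asboolP/negPn/negP => /norP[/asboolPn nMu].
(* The filter generated by [M] and [u] would be strictly larger and still miss [s]. *)
move=> /asboolPn nMus; apply: (Mmax [set y | M (u ==>' y)]).
  split=> [y My|/(_ u)]; last by move=> h; apply/nMu/h; exact: (fle_refl MF).
  by apply: filter_le My => //; apply/forces_imp => v vy _.
split=> //; right; split.
  split=> [|x y /= Muxy Mux]; first exact: fle_top.
  by move/(fle_imp MF): Muxy; apply=> //; exact: fle_refl.
by apply: filter_le Mt => //; apply/forces_imp => v vt _.
Qed.

(** * Diego's theorem: quotients in which a generator is the coatom *)

Lemma generated_relativize (G : set T) x t : generated G t ->
  exists2 t', generated (G `\ x) t' & t /\' x = t' /\' x.
Proof.
elim=> [y Gy||y z _ [y' gy' yE] _ [z' gz' zE]|y z _ [y' gy' yE] _ [z' gz' zE]].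
- have [->|yx] := pselect (y = x).
    (* Below [x] the generator [x] acts as [top], so [top] replaces it. *)
    exists top; first exact: generated_top.
    by rewrite (ismeetxx TP) (ismeetC TP) (ismeetx1 TP).
  by exists y => //; apply: generated_gen.
- by exists top => //; exact: generated_top.
- exists (y' /\' z'); first exact: generated_meet.
  apply: forces_eq => w; rewrite !forces_meet.
  have : w <=' y /\' x <-> w <=' y' /\' x by rewrite yE.
  have : w <=' z /\' x <-> w <=' z' /\' x by rewrite zE.
  by rewrite !forces_meet; tauto.
(* Below [x] an implication depends only on the meets of its arguments with [x]. *)
- exists (y' ==>' z'); first exact: generated_imp.
  apply: forces_eq => w; rewrite !forces_meet !forces_imp.
  have yyE v : v <=' y /\' x <-> v <=' y' /\' x by rewrite yE.
  have zzE v : v <=' z /\' x <-> v <=' z' /\' x by rewrite zE.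
  split=> -[h wx]; split=> // v vw vy;
    have := yyE v; have := zzE v; have := h v vw; have := is_trans vw wx;
    by rewrite !forces_meet; tauto.
Qed.

(* M is maximal among the filters missing x, tested on the generated
   subalgebra: in its quotient by M, x is the coatom. *)
Definition coatom_filter (G : set T) x (M : set T) :=
  [/\ is_filter M, ~ M x & forall u, generated G u -> M u \/ M (u ==>' x)].

(** Modulo [M] every generated element is 1 or below the coatom [s], and neither operation yields
    the coatom from arguments that both differ from it; so it must be the class of a generator. *)
Lemma coatom_filter_feq G M s : generated G s -> coatom_filter G s M ->
  exists2 x, G x & feq M x s.
Proof.
move=> gs [MF nMs Ms]; apply: contrapT => nG.
suff H t : generated G t -> ~ feq M t s by apply: (H s gs); exact: feq_refl.
elim=> {t} [x Gx xs||t u gt IHt gu IHu [tus stu]|t u gt IHt gu IHu [tus stu]].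
- by apply: nG; exists x.
- by move=> /(feq_filter MF)/(_ (filter_top MF)).
- have [st su] := (fle_meet MF _ _ _).1 stu.
  have [Mt|ts] := Ms t gt; last exact: IHt.
  have [Mu|us] := Ms u gu; last exact: IHu.
  by apply: nMs; apply: (filter_mp MF) tus _; exact: filter_meet.
(* If [t] is in [M], then [s] is congruent to [u]; otherwise [t] lies below [s], hence below
   [t ==>' u], which is then 1 in the quotient. *)
- have [Mt|ts] := Ms t gt.
    apply: IHu; split.
      apply: (fle_trans MF) tus => //; apply/(fle_imp MF) => v vu _.
      exact: vu.
    apply: ((fle_imp MF _ _ _).1 stu); first exact: fle_refl.
    apply: (fle_trans MF) (fle_top MF s) _; exact: (filter_fle MF _).1.
  apply: nMs; apply: (filter_mp MF) tus _.
  apply/(filter_fle MF _).2/(fle_imp MF) => v _ vt.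
  exact: ((fle_imp MF _ _ _).1 stu v (fle_trans MF vt ts) vt).
Qed.

Lemma coatom_filter_transfer G M s x : feq M x s -> coatom_filter G s M ->
  coatom_filter G x M.
Proof.
move=> [xs sx] [MF nMs Ms]; split=> // [Mx|u /Ms[|us]].
- by apply: nMs; exact: (filter_mp MF) xs Mx.
- by left.
- by right; exact: (fle_trans MF) sx.
Qed.

Definition reps (G : set T) x := generated (G `\ x) `|` [set x].

(** Unless [t] is 1, it is congruent to its meet with [x], hence to the meet of [x] with some [t']
    generated without [x]; as [t'] is 1 or below [x], that meet is [x] or [t']. *)
Lemma coatom_filter_reps G M x t : G x -> coatom_filter G x M ->
  generated G t -> exists2 d, reps G x d & feq M t d.
Proof.
move=> Gx [MF nMx Mx] gt.
have [Mt|tx] := Mx t gt.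
  exists top; first by left; exact: generated_top.
  by split; [exact: fle_top|exact: (filter_fle MF _).1].
have [t' gt' ttE] := generated_relativize x gt.
have gGt' : generated G t' by apply: generated_subset gt' => y [].
have ttx : feq M t (t' /\' x).
  rewrite -ttE; split; first by apply/(fle_meet MF); split=> //; exact: fle_refl.
  exact: fle_meetl.
have [Mt'|t'x] := Mx t' gGt'.
  exists x; first by right.
  apply: feq_trans ttx _ => //; split.
    exact: fle_meetr.
  apply/(fle_meet MF); split; last exact: fle_refl.
  by apply: (fle_trans MF) (fle_top MF x) _; exact: (filter_fle MF _).1.
exists t'; first by left.
apply: feq_trans ttx _ => //; split.
  exact: fle_meetl.
by apply/(fle_meet MF); split=> //; exact: fle_refl.
Qed.

Definition bimp x y := (x ==>' y) /\' (y ==>' x).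

(* Membership of these elements in M records the operation tables of the
   quotient by M in terms of the representatives D. *)
Definition table (D : set T) : set T :=
  D `|` [set bimp e d | e in [set a /\' b | a in D & b in D] `|`
                             [set a ==>' b | a in D & b in D] & d in D].

Lemma finite_table D : finite_set D -> finite_set (table D).
Proof.
move=> Dfin; rewrite finite_setU; split=> //; apply: finite_image2 => //.
by rewrite finite_setU; split; exact: finite_image2.
Qed.

(** By induction every generated element has a representative valid modulo both filters; the table
    carries the congruences from [M] over to [M']. *)
Lemma coatom_filter_determined G x M M' t : G x ->
  coatom_filter G x M -> coatom_filter G x M' ->
  (forall r, table (reps G x) r -> M r -> M' r) ->
  generated G t -> M t -> M' t.
Proof.
move=> Gx MP M'P MM' gt; have [MF _ _] := MP; have [M'F _ _] := M'P.
suff [d Dd [td t'd]] : exists2 d, reps G x d & feq M t d /\ feq M' t d.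
  move=> Mt; apply: feq_filter (feq_sym t'd) _ => //.
  by apply: MM'; [left|exact: feq_filter td _].
have rep e : generated G e ->
    (forall d, reps G x d -> table (reps G x) (bimp e d)) ->
    exists2 d, reps G x d & feq M e d /\ feq M' e d.
  move=> ge tab; have [d Dd ed] := coatom_filter_reps Gx MP ge.
  exists d => //; split=> //; apply: (feq_bimp M'F _ _).2; apply: MM'.
    exact: tab.
  exact: (feq_bimp MF _ _).1.
have genD d : reps G x d -> generated G d.
  move=> [|->]; last exact: generated_gen.
  by apply: generated_subset => y [].
elim: gt => {t} [y Gy||y z gy [d Dd [yd yd']] gz [e De [ze ze']]
                   |y z gy [d Dd [yd yd']] gz [e De [ze ze']]].
- exists y; last by split; exact: feq_refl.
  by have [->|yx] := pselect (y = x); [right|left; apply: generated_gen].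
- exists top; last by split; exact: feq_refl.
  by left; exact: generated_top.
- have [||f Df [f1 f2]] := rep (d /\' e).
  + by apply: generated_meet; exact: genD.
  + move=> f Df; right; exists (d /\' e); last by exists f.
    by left; exists d => //; exists e.
  + exists f => //; split; [apply: feq_trans f1|apply: feq_trans f2] => //;
      exact: feq_meet.
- have [||f Df [f1 f2]] := rep (d ==>' e).
  + by apply: generated_imp; exact: genD.
  + move=> f Df; right; exists (d ==>' e); last by exists f.
    by right; exists d => //; exists e.
  + exists f => //; split; [apply: feq_trans f1|apply: feq_trans f2] => //;
      exact: feq_imp.
Qed.

(** A generated element is determined by the coatom filters containing it; on generated elements
    each of these is determined by its coatom and its trace on the finite set [R]. *)
Lemma finite_generated_step G : finite_set G ->
  (forall x, G x -> finite_set (generated (G `\ x))) ->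
  finite_set (generated G).
Proof.
move=> Gfin IH; pose R := \bigcup_(x in G) table (reps G x).
have Rfin : finite_set R.
  apply: bigcup_finite => // x Gx; apply: finite_table.
  by rewrite finite_setU; split; [exact: IH|exact: finite_set1].
pose f t := [set p : T * set T |
  [/\ G p.1, p.2 `<=` R & exists M, [/\ coatom_filter G p.1 M,
     M `&` R = p.2 & M t]]].
have fle_f t s : generated G t -> generated G s -> f t = f s -> t <=' s.
  move=> gt gs fts; apply: contrapT => /maximal_filter[M [MF Mt nMs Ms]].
  have MsP : coatom_filter G s M by split=> // u _; exact: Ms.
  have [x Gx xs] := coatom_filter_feq gs MsP.
  have MP := coatom_filter_transfer xs MsP.
  have : f t (x, M `&` R) by split=> //=; exists M.
  (* [M'] may differ from [M], but it has the same coatom and trace, so [s] passes from [M'] to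
     [M]. *)
  rewrite fts => -[_ _ [M' [/= M'P M'R M's]]]; apply: nMs.
  apply: (@coatom_filter_determined G x M' M) => // r xr M'r.
  have : (M `&` R) r by rewrite -M'R; split=> //; exists x.
  by case.
apply: (@finite_set_injective_on _ _ _
          [set X | X `<=` G `*` [set Y | Y `<=` R]] f).
- by move=> t _ [x Y] [].
- by move=> t s gt gs fts; apply: is_anti; apply: fle_f.
- by apply/finite_powerset/finite_setX => //; exact: finite_powerset.
Qed.

End ImplicativeSemilattice.

(* Diego's theorem. *)
Theorem finite_generated (T : Type) (meet imp : T -> T -> T) (top : T)
    (G : set T) : implicative_semilattice meet imp top ->
  finite_set G -> finite_set (generated meet imp top G).
Proof.
elim/Pchoice: T => T in meet imp top G *; move=> TP /finite_seqP[s ->].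
(* Induction on the length of a list of generators, which drops when [x] is removed. The step also
   covers the empty list, where its hypothesis holds vacuously. *)
have [n] := ubnP (size s); elim: n => // n IHn in s *; rewrite ltnS => sn.
apply: (finite_generated_step TP) => [|x /= xs]; first exact: finite_seq.
rewrite (_ : _ `\ x = [set` [seq y <- s | y != x]]); last first.
  apply/seteqP; split=> y /=; rewrite mem_filter.
    by move=> [-> /eqP ->].
  by move=> /andP[/eqP yx ->].
apply: IHn; apply: leq_trans sn; rewrite size_filter.
by rewrite -(count_predC (predC1 x)) -[ltnLHS]addn0 ltn_add2l -has_count;
  apply/hasP; exists x => //=; rewrite negbK.
Qed.

(** * Substructures of inquisitive structures *)

Record inq_closed (A : inq_struct) (J : set A) : Prop := {
  closed_bot : J (ibot A);
  closed_meet : forall x y, J x -> J y -> J (imeet x y);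
  closed_join : forall x y, J x -> J y -> J (ijoin x y);
  closed_imp : forall x y, J x -> J y -> J (iimp x y)
}.

Section SubStructure.
Variables (A : inq_struct) (J C : set A) (Jcl : inq_closed J).

Definition sub_op (op : A -> A -> A)
    (op_cl : forall x y, J x -> J y -> J (op x y)) (x y : J) : J :=
  exist _ (op (val x) (val y))
    (mem_set (op_cl _ _ (set_mem (valP x)) (set_mem (valP y)))).

(** Carrier and core vary separately: the core closure is taken with the given core, and the joins
    of [H] with core [H]. *)
Definition sub_inq : inq_struct :=
  @InqStruct J [set x : J | C (val x)] (sub_op (closed_meet Jcl))
    (sub_op (closed_join Jcl)) (sub_op (closed_imp Jcl))
    (exist _ (ibot A) (mem_set (closed_bot Jcl))).

Definition sub_val (x : sub_inq) : A := val (x : J).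

Lemma sub_val_inj : injective sub_val. Proof. exact: val_inj. Qed.

Lemma sub_valP x : J (sub_val x). Proof. exact: set_mem (valP (x : J)). Qed.

Lemma sub_val_surj x : J x -> exists y, sub_val y = x.
Proof. by move=> Jx; exists (exist _ x (mem_set Jx)). Qed.

Lemma sub_core x : C (sub_val x) -> core sub_inq x. Proof. by []. Qed.

Lemma finite_sub_inq : finite_set J -> finite_set [set: sub_inq].
Proof.
apply: (@finite_set_injective_on _ _ _ _ sub_val) => [x _|x y _ _].
  exact: sub_valP.
exact: sub_val_inj.
Qed.

Lemma sub_val_eval (At : countType) (mu : At -> sub_inq) psi :
  sub_val (eval mu psi) = eval (sub_val \o mu) psi.
Proof. by elim: psi => //= psi1 <- psi2 <-. Qed.

(** Moving to a subtype turns laws relative to the core closure into laws on a whole type, the form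
    in which Diego's theorem applies. *)
Lemma sub_heyting : J `<=` @core_closure A -> inq_algebra A ->
  heyting_on [set: sub_inq] (@ijoin sub_inq) (@imeet sub_inq)
    (@iimp sub_inq) (ibot sub_inq).
Proof.
move=> JA [AH _ _].
have vA x : core_closure (sub_val x) by exact/JA/sub_valP.
have [[[_ mC mA mI] [_ jC jA jI] mab jab] [_ _ _ b0 res]] := AH.
have meetP : semilattice_on [set: sub_inq] (@imeet sub_inq).
  split=> // [x y _ _|x y z _ _ _|x _]; apply: sub_val_inj.
  - exact: mC (vA x) (vA y).
  - exact: mA (vA x) (vA y) (vA z).
  - exact: mI (vA x).
split; split=> //.
- split=> // [x y _ _|x y z _ _ _|x _]; apply: sub_val_inj.
  + exact: jC (vA x) (vA y).
  + exact: jA (vA x) (vA y) (vA z).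
  + exact: jI (vA x).
- by move=> x y _ _; apply: sub_val_inj; exact: mab (vA x) (vA y).
- by move=> x y _ _; apply: sub_val_inj; exact: jab (vA x) (vA y).
- by move=> x _; apply: sub_val_inj; exact: b0 (vA x).
- move=> x y z _ _ _; have {}res := res _ _ _ (vA x) (vA y) (vA z).
  by split=> /(congr1 sub_val) /res h; exact: sub_val_inj.
Qed.

(** A core valuation of the substructure is also one of [A] and evaluates to the same element, so
    validity of [L] is inherited. *)
Lemma sub_inq_L_algebra (At : countType) (L : set (formula At)) :
  J `<=` @core_closure A -> C `<=` core A -> C (ibot A) ->
  (forall x y, C x -> C y -> C (imeet x y)) ->
  (forall x y, C x -> C y -> C (iimp x y)) ->
  inq_L_algebra L A -> inq_L_algebra L sub_inq.
Proof.
move=> JA CA Cbot Cmeet Cimp [AP AL].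
have vA x : core_closure (sub_val x) by exact/JA/sub_valP.
have vC x : core sub_inq x -> core A (sub_val x) by exact: CA.
split; last first.
  move=> psi /AL psiA mu muC; apply: sub_val_inj; rewrite sub_val_eval.
  by rewrite psiA // => p; exact: vC.
have [[[_ mC mA mI] [_ jC jA jI] mab jab] [_ _ _ b0 res]] := sub_heyting JA AP.
have setTx (x : sub_inq) : [set: sub_inq] x by [].
split.
- split; split; [| | | | |exact: closure_imp|exact: closure_bot| |]; auto.
  + by split; auto; exact: closure_meet.
  + by split; auto; exact: closure_join.
  + by split; auto; exact: closure_meet.
- split; auto; last by move=> x y; exact: Cimp.
  by split; auto; move=> x y; exact: Cmeet.
- by move=> a x y aC _ _; apply: sub_val_inj; exact: (inq_split AP (vC _ aC)).
Qed.

End SubStructure.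

(** * Finite joins in a Heyting algebra *)

Section HeytingStructure.
Variable A : inq_struct.
Hypothesis AH :
  heyting_on [set: A] (@ijoin A) (@imeet A) (@iimp A) (ibot A).

Local Notation "x <=' y" := (imeet x y = x) (at level 70).

Lemma heyting_implicative :
  implicative_semilattice (@imeet A) (@iimp A) (itop A).
Proof.
have [_ [[_ mC mA mI] _ _ _ res]] := AH.
split=> *; [exact: mC|exact: mA|exact: mI| |exact: res].
by apply/res => //; rewrite -mA // mI.
Qed.

Let AI := heyting_implicative.

Lemma hle_joinl (x y : A) : x <=' ijoin x y.
Proof. by have [[_ _ mab _] _] := AH; exact: mab. Qed.

Lemma hle_joinr (x y : A) : y <=' ijoin x y.
Proof. by have [[_ [_ jC _ _] _ _] _] := AH; rewrite jC //; exact: hle_joinl. Qed.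

Lemma hjoin_le (x y z : A) : ijoin x y <=' z <-> x <=' z /\ y <=' z.
Proof.
split=> [xyz|[xz yz]].
  split; apply: (is_trans AI) xyz; [exact: hle_joinl|exact: hle_joinr].
have [[_ [_ jC jA _] mab jab] _] := AH.
have le_join u : u <=' z -> ijoin u z = z.
  by move=> uz; rewrite jC // -[in RHS](jab z u) // (ismeetC AI) uz.
have <- : ijoin (ijoin x y) z = z by rewrite -jA // !le_join.
exact: hle_joinl.
Qed.

Lemma hmeet_le (x y z : A) : imeet x y <=' z <-> x <=' iimp y z.
Proof. exact: isresidual AI x y z. Qed.

Lemma himp_swap (x y z : A) : x <=' iimp y z <-> y <=' iimp x z.
Proof.
have H u v : u <=' iimp v z -> v <=' iimp u z.
  by move=> /hmeet_le h; apply/hmeet_le; rewrite (ismeetC AI v).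
by split; exact: H.
Qed.

(** Distributivity from residuation: both sides have the same upper bounds. *)
Lemma hmeet_joinl (x y z : A) :
  imeet (ijoin x y) z = ijoin (imeet x z) (imeet y z).
Proof.
have ub w : imeet (ijoin x y) z <=' w <-> ijoin (imeet x z) (imeet y z) <=' w.
  by rewrite hmeet_le !hjoin_le !hmeet_le.
by apply: (is_anti AI); apply/ub; exact: is_refl AI _.
Qed.

Lemma himp_joinl (x y z : A) : iimp (ijoin x y) z = imeet (iimp x z) (iimp y z).
Proof.
apply: (forces_eq AI) => w.
by rewrite (forces_meet AI) himp_swap hjoin_le !(himp_swap _ w).
Qed.

Inductive joins (H : set A) : set A :=
| joins_base x : H x -> joins H x
| joins_join x y : joins H x -> joins H y -> joins H (ijoin x y).

Lemma joins_core_closure H :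
  H `<=` core A -> joins H `<=` @core_closure A.
Proof.
move=> HA x; elim=> [y /HA|y z _ ? _ ?]; first exact: closure_core.
exact: closure_join.
Qed.

(** A join of elements of [H] is determined by the elements of [H] below it, so [joins H] injects
    into the powerset of [H]. *)
Lemma finite_joins H : finite_set H -> finite_set (joins H).
Proof.
move=> /finite_powerset; pose f x := [set h | H h /\ h <=' x].
have fle x y : joins H x -> f x = f y -> x <=' y.
  have: f x `<=` f x by [].
  move=> + Jx fxy; rewrite {2}fxy => {fxy}.
  elim: Jx => {x} [x Hx sub|x1 x2 _ IH1 _ IH2 sub].
    by have [] := sub x (conj Hx (is_refl AI x)).
  apply/hjoin_le; split; [apply: IH1|apply: IH2] => h [Hh hx];
    apply: sub; split=> //; apply: (is_trans AI) hx _.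
    exact: hle_joinl.
  exact: hle_joinr.
apply: (@finite_set_injective_on _ _ _ _ f) => [x _ h []//|x y Jx Jy fxy].
by apply: (is_anti AI); apply: fle.
Qed.

(** Distributivity reduces meets to [H]. For implications, a join in the antecedent becomes a meet,
    and a join in the consequent is split once the antecedent lies in the core. *)
Lemma joins_closed H : inq_algebra A -> H `<=` core A -> H (ibot A) ->
  (forall x y, H x -> H y -> H (imeet x y)) ->
  (forall x y, H x -> H y -> H (iimp x y)) ->
  inq_closed (joins H).
Proof.
move=> AP HA Hbot Hmeet Himp.
have JA := joins_core_closure HA.
have Jmeet x y : joins H x -> joins H y -> joins H (imeet x y).
  move=> Jx Jy; elim: Jx => [{}x Hx|x1 x2 _ J1 _ J2]; last first.
    by rewrite hmeet_joinl; exact: joins_join.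
  elim: Jy => [{}y Hy|y1 y2 _ J1 _ J2]; first exact/joins_base/Hmeet.
  rewrite (ismeetC AI) hmeet_joinl !(ismeetC AI _ x); exact: joins_join.
split=> // [|x y|x y Jx Jy]; [exact: joins_base|exact: joins_join|].
elim: Jx => [{}x Hx|x1 x2 _ J1 _ J2]; last by rewrite himp_joinl; exact: Jmeet.
elim: Jy => [{}y Hy|y1 y2 /JA A1 J1 /JA A2 J2]; first exact/joins_base/Himp.
by rewrite (inq_split AP (HA _ Hx)) //; exact: joins_join.
Qed.

End HeytingStructure.

(** * The finite countermodel *)

Fixpoint atoms (At : countType) (phi : formula At) : seq At :=
  match phi with
  | Var p => [:: p]
  | Bot => [::]
  | And phi1 phi2 | Or phi1 phi2 | Imp phi1 phi2 => atoms phi1 ++ atoms phi2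
  end.

Lemma eq_in_eval (At : countType) (A : inq_struct) (mu nu : At -> A) phi :
  {in atoms phi, mu =1 nu} -> eval mu phi = eval nu phi.
Proof.
elim: phi => [p|//|f IHf g IHg|f IHf g IHg|f IHf g IHg] /= eq_mu;
  try (by rewrite IHf 1?IHg // => p fp; apply: eq_mu; rewrite mem_cat fp ?orbT).
by apply: eq_mu; rewrite mem_head.
Qed.

Lemma finite_countermodel (At : countType) (L : set (formula At))
    (A : inq_struct) (phi : formula At) :
  heyting_on [set: A] (@ijoin A) (@imeet A) (@iimp A) (ibot A) ->
  inq_L_algebra L A -> ~ core_valid A phi ->
  exists B : inq_struct,
    [/\ finite_set [set: B], inq_L_algebra L B & ~ core_valid B phi].
Proof.
move=> AH ALP; have [AP _] := ALP; have [_ [[cm _ _ _] ci cb _ _] _] := AP.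
move=> /existsNP[mu /not_implyP[muC muphi]].
(* Atoms outside [phi] are sent to 0, so that all values of [nu] lie in the finitely generated
   [H]. *)
pose nu p := if p \in atoms phi then mu p else ibot A.
have nuphi : eval nu phi <> itop A.
  by rewrite -(@eq_in_eval _ _ mu) // => p pphi; rewrite /nu pphi.
pose G := [set ibot A] `|` mu @` [set` atoms phi].
pose H := generated (@imeet A) (@iimp A) (itop A) G.
have Hfin : finite_set H.
  apply: finite_generated; first exact: heyting_implicative.
  by rewrite finite_setU; split=> //; exact/finite_image/finite_seq.
have HA : H `<=` core A.
  move=> x; elim=> [y [->//|[p _ <-]//]|||]; [exact: ci|move=> *; exact: cm|].
  by move=> *; exact: ci.
have Hbot : H (ibot A) by apply: generated_gen; left.
have Hmeet x y : H x -> H y -> H (imeet x y) by exact: generated_meet.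
have Himp x y : H x -> H y -> H (iimp x y) by exact: generated_imp.
have Jcl := joins_closed AH AP HA Hbot Hmeet Himp.
have JA := joins_core_closure HA.
exists (sub_inq H Jcl); split.
- exact/finite_sub_inq/finite_joins.
- exact: sub_inq_L_algebra.
- have nuH p : H (nu p).
    rewrite /nu; case: ifPn => // pphi.
    by apply: generated_gen; right; exists p.
  have /choice[nu' nu'E] p := sub_val_surj H Jcl (joins_base (nuH p)).
  move=> /(_ nu') valid; apply: nuphi.
  have -> : nu = @sub_val A (joins H) H Jcl \o nu'.
    by apply/funext => p /=; rewrite nu'E.
  rewrite -sub_val_eval valid // => p.
  by apply: sub_core; rewrite nu'E.
Qed.

Theorem theorem3p11 (At : countType) (L : set (formula At))
    (L_standard : forall psi, L psi -> standard psi)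
    (L_closed : standard_subst_closed L)
    (A : inq_struct) (phi : formula At) :
  inq_L_algebra L A -> ~ core_valid A phi ->
  exists B : inq_struct,
    [/\ finite_set [set: B], inq_L_algebra L B & ~ core_valid B phi].
Proof.
move=> ALP nvalid; have [AP _] := ALP; have [_ [[cm _ _ _] ci cb _ _] _] := AP.
have clA : inq_closed (@core_closure A).
  by split; [exact: closure_bot|exact: closure_meet|exact: closure_join
            |exact: closure_imp].
(* On the core closure, taken as a structure of its own, the Heyting laws hold everywhere; core
   valuations of [A] lift to it. *)
apply: (@finite_countermodel _ _ (sub_inq (core A) clA)).
- exact: sub_heyting.
- exact: sub_inq_L_algebra.
- move=> valid; apply: nvalid => mu muC.
  have /choice[mu' mu'E] p :=
    sub_val_surj (core A) clA (closure_core (muC p)).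
  have -> : mu = @sub_val A _ (core A) clA \o mu'.
    by apply/funext => p /=; rewrite mu'E.
  rewrite -sub_val_eval valid // => p.
  by apply: sub_core; rewrite mu'E.
Qed.
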